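(* The category $\mathcal{N}ec$ of necklaces is a test category. Explicitly: (1) the nerve $N(\mathcal{N}ec)$ is weakly contractible; and (2) for every small category $\mathcal{D}$ with a terminal object, the presheaf $\iota^{*}(\mathcal{D}) : \mathcal{N}ec^{op}\to \mathrm{Set}$, $T\mapsto \mathrm{Fun}(\mathcal{N}ec/T,\mathcal{D})$, is aspherical, i.e. for every necklace $T$, the category of elements $\int_{\mathcal{N}ec}(\hat{T}\times \iota^{*}(\mathcal{D}))$ has weakly contractible nerve, where $\hat{T}=\mathcal{N}ec(-,T)$.
   Context: **Necklaces.** Let $\mathrm{SSet}_{*,*} = \mathrm{SSet}_{\partial\Delta^{1}/}$ be the category of bipointed simplicial sets: objects are simplicial sets $K$ with an ordered pair of (not necessarily distinct) vertices $(a,b)$, written $K_{a,b}$, and morphisms are simplicial maps preserving the first and the second basepoint. The wedge sum $K\vee L$ of $K_{a,b}$ and $L_{c,d}$ is the quotient of $K\amalg L$ obtained by identifying the vertex $b$ with the vertex $c$ (the coequalizer of $b,c:\Delta^{0}\rightrightarrows K\amalg L$), bipointed at $(a,d)$. The standard simplex $\Delta^{n}$ is always bipointed at $(0,n)$. The category $\mathcal{N}ec$ of necklaces is the full subcategory of $\mathrm{SSet}_{*,*}$ spanned by the bipointed simplicial sets of the form $T=\Delta^{n_{1}}\vee\dots\vee\Delta^{n_{k}}$ with $k\geq 0$ and each $n_{i}>0$ (for $k=0$ this is $\Delta^{0}$). It is regarded as a small category, with one object for each finite sequence $(n_1,\dots,n_k)$ of positive integers. **Test categories** (conventions of Jardine,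 ''Categorical homotopy theory''). Let $\mathcal{A}$ be a small category. An $\mathcal{A}$-set is a presheaf $\mathcal{A}^{op}\to\mathrm{Set}$; for $a\in\mathcal{A}$ write $\hat{a}=\mathcal{A}(-,a)$. For an $\mathcal{A}$-set $X$, $\int_{\mathcal{A}}X$ denotes its category of elements: objects are pairs $(a,x)$ with $a\in\mathcal{A}$, $x\in X(a)$, and morphisms $(a,x)\to(b,y)$ are morphisms $u:a\to b$ in $\mathcal{A}$ with $X(u)(y)=x$. For a small category $\mathcal{D}$, $\iota^{*}(\mathcal{D})$ is the $\mathcal{A}$-set $a\mapsto \mathrm{Fun}(\mathcal{A}/a,\mathcal{D})$ (the set of functors from the slice category $\mathcal{A}/a$ to $\mathcal{D}$), with functoriality by precomposition with the functors $\mathcal{A}/a\to\mathcal{A}/b$ induced by morphisms $a\to b$. Let $N:\mathrm{Cat}\to\mathrm{SSet}$ be the nerve. A small category $\mathcal{C}$ is aspherical if $N(\mathcal{C})$ is weakly contractible (i.e. $N(\mathcal{C})\to\Delta^{0}$ is a weak homotopy equivalence). A functor $F:\mathcal{C}\to\mathcal{D}$ between small categories is aspherical if for every $d\in\mathcal{D}$ the comma category $F/d$ (objects: pairs $(c, F(c)\to d)$) is aspherical. An $\mathcal{A}$-set $X$ is aspherical if the forgetful functor $\int_{\mathcal{A}}X\to\mathcal{A}$ is aspherical; equivalently, if the category $\int_{\mathcal{A}}(\hat{a}\times X)$ is aspherical for all $a\in\mathcal{A}$. $\mathcal{A}$ is a local test category if for every small category $\mathcal{D}$ with a terminal object, the $\mathcal{A}$-set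 $\iota^{*}(\mathcal{D})$ is aspherical. $\mathcal{A}$ is a test category if it is a local test category and $\mathcal{A}$ is aspherical. *)

(* Defs.v *)
From Stdlib Require Import Relation_Operators.
From mathcomp Require Import all_boot.
From mathcomp Require Import boolp.

Set Implicit Arguments.
Unset Strict Implicit.
Unset Printing Implicit Defensive.

Declare Scope cat_scope.
Delimit Scope cat_scope with cat.
Local Open Scope cat_scope.
Local Open Scope quotient_scope.

(** * Small categories and functors *)

Record category := Category {
  obj :> Type;
  hom : obj -> obj -> Type;
  idm : forall x, hom x x;
  comp : forall x y z, hom y z -> hom x y -> hom x z;
  comp_idl : forall x y (f : hom x y), comp (idm y) f = f;
  comp_idr : forall x y (f : hom x y), comp f (idm x) = f;
  compA : forall x y z t (h : hom z t) (g : hom y z) (f : hom x y),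
    comp h (comp g f) = comp (comp h g) f }.

Arguments hom {c} x y.
Arguments idm {c} x.
Arguments comp {c x y z} g f.

Notation "g '∘' f" := (comp g f) (at level 40, left associativity) : cat_scope.

Record functor (C D : category) := Functor {
  fobj :> C -> D;
  fmap : forall x y : C, hom x y -> hom (fobj x) (fobj y);
  fmap_id : forall x, fmap (idm x) = idm (fobj x);
  fmap_comp : forall x y z (g : hom y z) (f : hom x y),
    fmap (g ∘ f) = fmap g ∘ fmap f }.

Arguments fmap {C D} F {x y} f : rename.

Definition terminal (C : category) (t : C) : Prop :=
  forall x : C, exists! f : hom x t, True.

Definition has_terminal (C : category) : Prop := exists t : C, terminal t.

Section FunctorComp.
Variables C D E : category.

Program Definition functor_comp (G : functor D E) (F : functor C D) :
    functor C E :=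
  @Functor C E (fun x => G (F x)) (fun x y f => fmap G (fmap F f)) _ _.
Next Obligation. by rewrite !fmap_id. Qed.
Next Obligation. by rewrite !fmap_comp. Qed.

End FunctorComp.

Program Definition functor_id (C : category) : functor C C :=
  @Functor C C (fun x => x) (fun x y f => f) _ _.

Lemma functor_compA (A B C D : category) (H : functor C D) (G : functor B C)
    (F : functor A B) :
  functor_comp H (functor_comp G F) = functor_comp (functor_comp H G) F.
Proof. by congr Functor. Qed.

Lemma functor_compr1 (C D : category) (F : functor C D) :
  functor_comp F (functor_id C) = F.
Proof. by case: F => o m mi mc; congr Functor. Qed.

(* Strict equality of functors; comparing the values on arrows together with
   their endpoints avoids transporting along equalities of objects. *)
Lemma functor_eq (C D : category) (F G : functor C D) :
  (forall x, F x = G x) ->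
  (forall x y (f : hom x y),
    existT (fun p : D * D => hom p.1 p.2) (F x, F y) (fmap F f) =
    existT (fun p : D * D => hom p.1 p.2) (G x, G y) (fmap G f)) ->
  F = G.
Proof.
case: F => Fo Fm Fi Fc; case: G => Go Gm Gi Gc /= /funext eqo.
case: _ / eqo Gm Gi Gc => Gm Gi Gc eqm.
have eqFG : Fm = Gm.
  apply: functional_extensionality_dep => x.
  apply: functional_extensionality_dep => y.
  apply: functional_extensionality_dep => f.
  have e : forall (p : D * D) (u v : hom p.1 p.2),
      existT (fun p : D * D => hom p.1 p.2) p u = existT _ p v -> u = v.
    move=> p u v euv.
    have h (s t : {p : D * D & hom p.1 p.2}) (st : s = t) :
        {q : projT1 s = projT1 t
           | eq_rect _ (fun p : D * D => hom p.1 p.2) (projT2 s) _ q = projT2 t}.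
      by case: _ / st; exists erefl.
    case: (h _ _ euv) => /= q <-.
    by rewrite (Prop_irrelevance q erefl).
  exact: (e (Fo x, Fo y)) (eqm x y f).
by case: _ / eqFG Gi Gc => Gi Gc; congr Functor.
Qed.

(** * Slices and comma categories *)

Section Slice.
Variables (C : category) (a : C).

Definition slice_obj := {x : C & hom x a}.

Definition slice_hom (s t : slice_obj) :=
  {f : hom (projT1 s) (projT1 t) | projT2 t ∘ f = projT2 s}.

Lemma slice_hom_eq (s t : slice_obj) (f g : slice_hom s t) :
  sval f = sval g -> f = g.
Proof. by case: f g => [f pf] [g pg] /= fg; apply: eq_exist. Qed.

Program Definition slice : category :=
  @Category slice_obj slice_hom
    (fun s => exist _ (idm (projT1 s)) _)
    (fun s t r g f => exist _ (sval g ∘ sval f) _) _ _ _.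
Next Obligation. exact: comp_idr. Qed.
Next Obligation. by rewrite compA (svalP g) (svalP f). Qed.
Next Obligation. by apply: slice_hom_eq; apply: comp_idl. Qed.
Next Obligation. by apply: slice_hom_eq; apply: comp_idr. Qed.
Next Obligation. by apply: slice_hom_eq; apply: compA. Qed.

End Slice.

Program Definition slice_map (C : category) (a b : C) (u : hom a b) :
    functor (slice a) (slice b) :=
  @Functor (slice a) (slice b)
    (fun s => existT _ (projT1 s) (u ∘ projT2 s))
    (fun s t f => exist _ (sval f) _) _ _.
Next Obligation. by rewrite -compA (svalP f). Qed.
Next Obligation. exact: slice_hom_eq. Qed.
Next Obligation. exact: slice_hom_eq. Qed.

Lemma slice_arrow_eq (C : category) (a x y : C) (f f' : hom x a)
    (g g' : hom y a) (h : hom x y) (e : g ∘ h = f) (e' : g' ∘ h = f') :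
  f = f' -> g = g' ->
  existT (fun p : slice a * slice a => hom p.1 p.2)
    (existT _ x f, existT _ y g) (exist _ h e) =
  existT (fun p : slice a * slice a => hom p.1 p.2)
    (existT _ x f', existT _ y g') (exist _ h e').
Proof.
move=> ef eg; case: _ / ef e' => e'; case: _ / eg e' => e'.
by rewrite (Prop_irrelevance e e').
Qed.

Lemma slice_map_id (C : category) (a : C) :
  slice_map (idm a) = functor_id (slice a).
Proof.
apply: functor_eq => [[x f]|[x f] [y g] [h e]] /=; first by rewrite comp_idl.
by apply: slice_arrow_eq; rewrite comp_idl.
Qed.

Lemma slice_map_comp (C : category) (a b c : C) (v : hom b c) (u : hom a b) :
  slice_map (v ∘ u) = functor_comp (slice_map v) (slice_map u).
Proof.
apply: functor_eq => [[x f]|[x f] [y g] [h e]] /=; first by rewrite compA.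
by apply: slice_arrow_eq; rewrite compA.
Qed.

Section Comma.
Variables (C D : category) (F : functor C D) (d : D).

Definition comma_obj := {c : C & hom (F c) d}.

Definition comma_hom (s t : comma_obj) :=
  {f : hom (projT1 s) (projT1 t) | projT2 t ∘ fmap F f = projT2 s}.

Lemma comma_hom_eq (s t : comma_obj) (f g : comma_hom s t) :
  sval f = sval g -> f = g.
Proof. by case: f g => [f pf] [g pg] /= fg; apply: eq_exist. Qed.

Program Definition comma : category :=
  @Category comma_obj comma_hom
    (fun s => exist _ (idm (projT1 s)) _)
    (fun s t r g f => exist _ (sval g ∘ sval f) _) _ _ _.
Next Obligation. by rewrite fmap_id comp_idr. Qed.
Next Obligation. by rewrite fmap_comp compA (svalP g) (svalP f). Qed.
Next Obligation. by apply: comma_hom_eq; apply: comp_idl. Qed.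
Next Obligation. by apply: comma_hom_eq; apply: comp_idr. Qed.
Next Obligation. by apply: comma_hom_eq; apply: compA. Qed.

End Comma.

(** * Presheaves *)

Record presheaf (A : category) := Presheaf {
  sections :> A -> Type;
  restr : forall a b : A, hom a b -> sections b -> sections a;
  restr_id : forall a (x : sections a), restr (idm a) x = x;
  restr_comp : forall a b c (v : hom b c) (u : hom a b) (x : sections c),
    restr (v ∘ u) x = restr u (restr v x) }.

Arguments restr {A} X {a b} u x : rename.

Record presheaf_map (A : category) (X Y : presheaf A) := PresheafMap {
  component :> forall a : A, X a -> Y a;
  component_nat : forall (a b : A) (u : hom a b) (x : X b),
    component (restr X u x) = restr Y u (component x) }.

Program Definition presheaf_map_comp (A : category) (X Y Z : presheaf A)
    (g : presheaf_map Y Z) (f : presheaf_map X Y) : presheaf_map X Z :=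
  @PresheafMap A X Z (fun a x => g a (f a x)) _.
Next Obligation. by rewrite !component_nat. Qed.

Lemma presheaf_map_eq (A : category) (X Y : presheaf A)
    (f g : presheaf_map X Y) : (forall a x, f a x = g a x) -> f = g.
Proof.
case: f g => [f fn] [g gn] /= fg.
have efg : f = g.
  apply: functional_extensionality_dep => a; exact/funext/fg.
by case: _ / efg gn => gn; rewrite (Prop_irrelevance fn gn).
Qed.

Program Definition yoneda (A : category) (a : A) : presheaf A :=
  @Presheaf A (fun b => hom b a) (fun b c u f => f ∘ u) _ _.
Next Obligation. exact: comp_idr. Qed.
Next Obligation. exact: compA. Qed.

Program Definition yoneda_map (A : category) (a : A) (X : presheaf A)
    (x : X a) : presheaf_map (yoneda a) X :=
  @PresheafMap A (yoneda a) X (fun b f => restr X f x) _.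
Next Obligation. exact: restr_comp. Qed.

Program Definition presheaf_prod (A : category) (X Y : presheaf A) :
    presheaf A :=
  @Presheaf A (fun a => (X a * Y a)%type)
    (fun a b u p => (restr X u p.1, restr Y u p.2)) _ _.
Next Obligation. by rewrite !restr_id. Qed.
Next Obligation. by rewrite !restr_comp. Qed.

Program Definition presheaf_coprod (A : category) (X Y : presheaf A) :
    presheaf A :=
  @Presheaf A (fun a => (X a + Y a)%type)
    (fun a b u s => match s with
       | inl x => inl (restr X u x)
       | inr y => inr (restr Y u y)
     end) _ _.
Next Obligation. by case: x => x; rewrite restr_id. Qed.
Next Obligation. by case: x => x; rewrite restr_comp. Qed.

Program Definition presheaf_inl (A : category) (X Y : presheaf A) :
    presheaf_map X (presheaf_coprod X Y) :=
  @PresheafMap A X (presheaf_coprod X Y) (fun a x => inl x) _.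

Program Definition presheaf_inr (A : category) (X Y : presheaf A) :
    presheaf_map Y (presheaf_coprod X Y) :=
  @PresheafMap A Y (presheaf_coprod X Y) (fun a y => inr y) _.

Section Coequalizer.
Variables (A : category) (X Y : presheaf A) (f g : presheaf_map X Y).

Definition coeq_gen (a : A) (y y' : Y a) : Prop :=
  exists x : X a, y = f a x /\ y' = g a x.

Definition coeq_rel (a : A) : rel {classic Y a} :=
  fun y y' => `[< clos_refl_sym_trans (Y a) (@coeq_gen a) y y' >].

Lemma coeq_relP (a : A) : equiv_class_of (coeq_rel (a := a)).
Proof.
split.
- by move=> y; apply/asboolP; apply: rst_refl.
- by move=> y z; apply/asboolP/asboolP => h; apply: rst_sym.
- move=> y x z /asboolP xy /asboolP yz; apply/asboolP.
  exact: rst_trans xy yz.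
Qed.

Canonical coeq_equiv (a : A) : equiv_rel {classic Y a} :=
  EquivRelPack (coeq_relP a).

Definition coeq_sections (a : A) : Type := {eq_quot (coeq_equiv a)}.

Definition coeq_pi (a : A) (y : Y a) : coeq_sections a :=
  \pi_({eq_quot (coeq_equiv a)}) (y : {classic Y a}).

Definition coeq_repr (a : A) (q : coeq_sections a) : Y a :=
  repr (q : {eq_quot (coeq_equiv a)}).

Lemma coeq_reprK (a : A) (q : coeq_sections a) : coeq_pi (coeq_repr q) = q.
Proof. exact: reprK. Qed.

Lemma coeq_piP (a : A) (y y' : Y a) :
  coeq_pi y = coeq_pi y' <-> clos_refl_sym_trans (Y a) (@coeq_gen a) y y'.
Proof.
by split=> [/eqmodP/asboolP //|h]; apply/eqmodP/asboolP.
Qed.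

Definition coeq_restr (a b : A) (u : hom a b) (q : coeq_sections b) :
    coeq_sections a :=
  coeq_pi (restr Y u (coeq_repr q)).

Lemma coeq_restr_pi (a b : A) (u : hom a b) (y : Y b) :
  coeq_restr u (coeq_pi y) = coeq_pi (restr Y u y).
Proof.
apply/coeq_piP; have /coeq_piP := coeq_reprK (coeq_pi y).
move: (coeq_repr _) => y'.
elim=> [z z' [x [-> ->]]|z|z z' _|z z' z'' _ h _].
- by apply: rst_step; exists (restr X u x); rewrite !component_nat.
- exact: rst_refl.
- exact: rst_sym.
- exact: rst_trans.
Qed.

Program Definition coequalizer : presheaf A :=
  @Presheaf A coeq_sections coeq_restr _ _.
Next Obligation. by rewrite /coeq_restr restr_id coeq_reprK. Qed.
Next Obligation. by rewrite -(coeq_reprK x) !coeq_restr_pi restr_comp. Qed.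

Program Definition coequalizer_map : presheaf_map Y coequalizer :=
  @PresheafMap A Y coequalizer coeq_pi _.
Next Obligation. by rewrite coeq_restr_pi. Qed.

End Coequalizer.

Section Elements.
Variables (A : category) (X : presheaf A).

Definition elements_obj := {a : A & X a}.

Definition elements_hom (s t : elements_obj) :=
  {u : hom (projT1 s) (projT1 t) | restr X u (projT2 t) = projT2 s}.

Lemma elements_hom_eq (s t : elements_obj) (f g : elements_hom s t) :
  sval f = sval g -> f = g.
Proof. by case: f g => [f pf] [g pg] /= fg; apply: eq_exist. Qed.

Program Definition elements : category :=
  @Category elements_obj elements_hom
    (fun s => exist _ (idm (projT1 s)) _)
    (fun s t r g f => exist _ (sval g ∘ sval f) _) _ _ _.
Next Obligation. exact: restr_id. Qed.
Next Obligation. by rewrite restr_comp (svalP g) (svalP f). Qed.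
Next Obligation. by apply: elements_hom_eq; apply: comp_idl. Qed.
Next Obligation. by apply: elements_hom_eq; apply: comp_idr. Qed.
Next Obligation. by apply: elements_hom_eq; apply: compA. Qed.

Program Definition elements_forget : functor elements A :=
  @Functor elements A (fun s => projT1 s) (fun s t f => sval f) _ _.

End Elements.

Program Definition iota_star (A D : category) : presheaf A :=
  @Presheaf A (fun a => functor (slice a) D)
    (fun a b u F => functor_comp F (slice_map u)) _ _.
Next Obligation. by rewrite slice_map_id functor_compr1. Qed.
Next Obligation. by rewrite slice_map_comp functor_compA. Qed.

(** * Simplicial sets *)

(* The object [n : nat] of [Delta] stands for the ordinal {0, ..., n}. *)
Definition is_monotone (m n : nat) (f : 'I_m.+1 -> 'I_n.+1) : Prop :=
  {homo f : i j / i <= j}.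

Definition monotone (m n : nat) := {f : 'I_m.+1 -> 'I_n.+1 | is_monotone f}.

Definition monotone_fun (m n : nat) (f : monotone m n) : 'I_m.+1 -> 'I_n.+1 :=
  sval f.
Coercion monotone_fun : monotone >-> Funclass.

Lemma monotone_eq (m n : nat) (f g : monotone m n) : f =1 g -> f = g.
Proof.
by case: f g => [f pf] [g pg] /= fg; apply: eq_exist; apply/funext/fg.
Qed.

Definition monotone_id (n : nat) : monotone n n :=
  exist (@is_monotone n n) id (fun i j ij => ij).

Definition monotone_comp (m n p : nat) (g : monotone n p) (f : monotone m n) :
    monotone m p :=
  exist (@is_monotone m p) (g \o f) (fun i j ij => svalP g _ _ (svalP f i j ij)).

Program Definition Delta : category :=
  @Category nat monotone monotone_id monotone_comp _ _ _.
Next Obligation. exact: monotone_eq. Qed.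
Next Obligation. exact: monotone_eq. Qed.
Next Obligation. exact: monotone_eq. Qed.

Notation sset := (presheaf Delta).
Notation smap := (presheaf_map (A := Delta)).

Definition simplex (n : nat) : sset := yoneda (n : Delta).

Definition simplex_const (n m : nat) (i : 'I_n.+1) : simplex n m :=
  exist (@is_monotone m n) (fun _ => i) (fun _ _ _ => leqnn i).

Program Definition to_point (X : sset) : smap X (simplex 0) :=
  @PresheafMap Delta X (simplex 0) (fun m _ => simplex_const m ord0) _.
Next Obligation. exact: monotone_eq. Qed.

(* The horn is the union of the faces of [simplex n] opposite to a vertex
   other than [k]. *)
Definition in_horn (n : nat) (k : 'I_n.+1) (m : nat) (s : monotone m n) : Prop :=
  exists2 j, j != k & forall i, s i != j.

Lemma in_horn_comp (n : nat) (k : 'I_n.+1) (m p : nat) (s : monotone p n)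
    (u : monotone m p) : in_horn k s -> in_horn k (monotone_comp s u).
Proof. by case=> j jk sj; exists j => // i; apply: sj. Qed.

Program Definition horn (n : nat) (k : 'I_n.+1) : sset :=
  @Presheaf Delta (fun m => {s : simplex n m | in_horn k s})
    (fun m p u s =>
       exist _ (restr (simplex n) u (sval s)) (in_horn_comp u (svalP s))) _ _.
Next Obligation. by apply: eq_exist; apply: monotone_eq. Qed.
Next Obligation. by apply: eq_exist; apply: monotone_eq. Qed.

Program Definition horn_incl (n : nat) (k : 'I_n.+1) :
    smap (horn k) (simplex n) :=
  @PresheafMap Delta (horn k) (simplex n) (fun m s => sval s) _.

Definition kan_complex (Z : sset) : Prop :=
  forall (n : nat) (k : 'I_n.+1), 0 < n ->
  forall h : smap (horn k) Z, exists g : smap (simplex n) Z,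
    presheaf_map_comp g (horn_incl k) = h.

(* An edge from [f] to [g] in the mapping complex Fun(X, Z). *)
Definition simplicial_homotopy (X Z : sset) (f g : smap X Z) : Prop :=
  exists H : smap (presheaf_prod X (simplex 1)) Z,
    (forall m (x : X m), H m (x, simplex_const m ord0) = f m x) /\
    (forall m (x : X m), H m (x, simplex_const m ord_max) = g m x).

(* Being in the same component of Fun(X, Z). *)
Definition homotopic (X Z : sset) : smap X Z -> smap X Z -> Prop :=
  clos_refl_sym_trans (smap X Z) (@simplicial_homotopy X Z).

(* Precomposition with [f] is a bijection pi_0 Fun(Y, Z) -> pi_0 Fun(X, Z) for
   every Kan complex [Z]. *)
Definition weak_homotopy_equivalence (X Y : sset) (f : smap X Y) : Prop :=
  forall Z : sset, kan_complex Z ->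
    (forall g g' : smap Y Z,
       homotopic (presheaf_map_comp g f) (presheaf_map_comp g' f) ->
       homotopic g g') /\
    (forall h : smap X Z, exists g : smap Y Z,
       homotopic (presheaf_map_comp g f) h).

Definition weakly_contractible (X : sset) : Prop :=
  weak_homotopy_equivalence (to_point X).

(** * Nerves and asphericity *)

Program Definition ord_category (n : nat) : category :=
  @Category 'I_n.+1 (fun i j => i <= j) (fun i => leqnn i)
    (fun i j k jk ij => leq_trans ij jk) _ _ _.

Program Definition ord_functor (m n : nat) (f : monotone m n) :
    functor (ord_category m) (ord_category n) :=
  @Functor (ord_category m) (ord_category n) f (fun i j ij => svalP f i j ij)
    _ _.

Lemma ord_functor_id (n : nat) :
  ord_functor (monotone_id n) = functor_id (ord_category n).
Proof.
by apply: functor_eq => // i j ij; congr existT; apply: bool_irrelevance.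
Qed.

Lemma ord_functor_comp (m n p : nat) (g : monotone n p) (f : monotone m n) :
  ord_functor (monotone_comp g f) =
  functor_comp (ord_functor g) (ord_functor f).
Proof.
by apply: functor_eq => // i j ij; congr existT; apply: bool_irrelevance.
Qed.

Program Definition nerve (C : category) : sset :=
  @Presheaf Delta (fun n => functor (ord_category n) C)
    (fun m n u F => functor_comp F (ord_functor u)) _ _.
Next Obligation. by rewrite ord_functor_id functor_compr1. Qed.
Next Obligation. by rewrite ord_functor_comp functor_compA. Qed.

Definition aspherical (C : category) : Prop := weakly_contractible (nerve C).

Definition aspherical_functor (C D : category) (F : functor C D) : Prop :=
  forall d : D, aspherical (comma F d).

Definition aspherical_presheaf (A : category) (X : presheaf A) : Prop :=
  aspherical_functor (elements_forget X).

Definition local_test_category (A : category) : Prop :=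
  forall D : category, has_terminal D -> aspherical_presheaf (iota_star A D).

Definition test_category (A : category) : Prop :=
  local_test_category A /\ aspherical A.

(** * Necklaces *)

Record bipointed := Bipointed {
  bip_sset :> sset;
  bip_fst : bip_sset 0;
  bip_snd : bip_sset 0 }.

Arguments bip_fst : clear implicits.
Arguments bip_snd : clear implicits.

Definition bipointed_map (K L : bipointed) :=
  {f : smap K L |
    f 0 (bip_fst K) = bip_fst L /\ f 0 (bip_snd K) = bip_snd L}.

Lemma bipointed_map_eq (K L : bipointed) (f g : bipointed_map K L) :
  (forall n x, sval f n x = sval g n x) -> f = g.
Proof.
case: f g => [f pf] [g pg] /= fg; apply: eq_exist.
exact: presheaf_map_eq.
Qed.

Program Definition bipointed_id (K : bipointed) : bipointed_map K K :=
  exist _ (@PresheafMap Delta K K (fun n x => x) _) _.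

Program Definition bipointed_comp (K L M : bipointed)
    (g : bipointed_map L M) (f : bipointed_map K L) : bipointed_map K M :=
  exist _ (presheaf_map_comp (sval g) (sval f)) _.
Next Obligation.
by case: f g => [f [f0 f1]] [g [g0 g1]] /=; rewrite f0 f1.
Qed.

Definition std_simplex (n : nat) : bipointed :=
  @Bipointed (simplex n) (simplex_const 0 ord0) (simplex_const 0 ord_max).

Section Wedge.
Variables K L : bipointed.

Definition wedge_fst : smap (simplex 0) (presheaf_coprod K L) :=
  yoneda_map (presheaf_inl K L 0 (bip_snd K)).

Definition wedge_snd : smap (simplex 0) (presheaf_coprod K L) :=
  yoneda_map (presheaf_inr K L 0 (bip_fst L)).

Definition wedge : bipointed :=
  @Bipointed (coequalizer wedge_fst wedge_snd)
    (coequalizer_map wedge_fst wedge_snd 0 (presheaf_inl K L 0 (bip_fst K)))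
    (coequalizer_map wedge_fst wedge_snd 0 (presheaf_inr K L 0 (bip_snd L))).

End Wedge.

Definition necklace := seq {n : nat | 0 < n}.

(* The iterated wedge is bracketed to the right and ends with the empty wedge
   [std_simplex 0], a unit for [wedge] up to isomorphism. *)
Definition necklace_sset (T : necklace) : bipointed :=
  foldr (fun n K => wedge (std_simplex (sval n)) K) (std_simplex 0) T.

(* Arrows are all maps of bipointed simplicial sets: Nec is full. *)
Program Definition Nec : category :=
  @Category necklace
    (fun S T => bipointed_map (necklace_sset S) (necklace_sset T))
    (fun T => bipointed_id (necklace_sset T))
    (fun S T U g f => bipointed_comp g f) _ _ _.
Next Obligation. exact: bipointed_map_eq. Qed.
Next Obligation. exact: bipointed_map_eq. Qed.
Next Obligation. exact: bipointed_map_eq. Qed.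

(* Main.v *)
(** For a necklace S, the inclusions of the long edge Delta^1 and of the inner
path Delta^1 v Delta^1 in Delta^2 induce natural maps
  Delta^1 v S -> Delta^2 v S <- Delta^1 v Delta^1 v S,
and collapsing the first bead is a natural map Delta^2 v S -> S.  The maps
U -> Delta^2 v S from a necklace that avoid the vertex 1 of Delta^2 form a
sieve, natural in S.  It contains every map through Delta^1 v S, and no map
through Delta^1 v Delta^1 v S, because a path between the endpoints cannot
jump over a joint.  Let e be terminal in D.  A functor F on Nec/S pulls back
along the collapse, and its pullback can be replaced by e off the sieve; call
the result F'.  This gives natural transformations on the category of elements
of T^ x iota^*(D),
  (S, s, F) <- (Delta^1 v S, -, F) -> (Delta^2 v S, -, F')
    <- (Delta^1 v Delta^1 v S, -, e) -> (T, id, e),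
which join the identity to a constant functor.  Natural transformations become
homotopies on nerves. *)

From Stdlib Require Import Relation_Operators.
From mathcomp Require Import all_boot.
From mathcomp Require Import boolp.
Require Import Defs.

Set Implicit Arguments.
Unset Strict Implicit.
Unset Printing Implicit Defensive.

Local Open Scope cat_scope.

(** * Zigzags of natural transformations *)

Definition natural_step (C D : category) (F G : functor C D) : Prop :=
  exists eta : forall x, hom (F x) (G x),
    forall x y (f : hom x y), eta y ∘ fmap F f = fmap G f ∘ eta x.

Definition linked (C D : category) : functor C D -> functor C D -> Prop :=
  clos_refl_sym_trans (functor C D) (@natural_step C D).

Program Definition functor_const (C D : category) (d : D) : functor C D :=
  @Functor C D (fun _ => d) (fun _ _ _ => idm d) _ _.
Next Obligation. by rewrite comp_idl. Qed.

(** A zigzag of natural transformations from the identity to a constant functor becomes a chain of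
    homotopies on the nerve, hence gives asphericity. *)
Definition contractible (C : category) : Prop :=
  exists x : C, linked (functor_id C) (functor_const C x).

Program Definition cat_prod (C D : category) : category :=
  @Category (C * D)%type (fun p q => (hom p.1 q.1 * hom p.2 q.2)%type)
    (fun p => (idm p.1, idm p.2))
    (fun p q r g f => (g.1 ∘ f.1, g.2 ∘ f.2)) _ _ _.
Next Obligation. by rewrite !comp_idl. Qed.
Next Obligation. by rewrite !comp_idr. Qed.
Next Obligation. by rewrite !compA. Qed.

Program Definition functor_pair (C D E : category) (F : functor C D)
    (G : functor C E) : functor C (cat_prod D E) :=
  @Functor C (cat_prod D E) (fun x => (F x, G x))
    (fun x y f => (fmap F f, fmap G f)) _ _.
Next Obligation. by rewrite !fmap_id. Qed.
Next Obligation. by rewrite !fmap_comp. Qed.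

(** * From natural transformations to homotopies of nerves *)

Section Cylinder.
Variables (C D : category) (F G : functor C D).
Variable eta : forall x, hom (F x) (G x).
Hypothesis eta_nat :
  forall x y (f : hom x y), eta y ∘ fmap F f = fmap G f ∘ eta x.

Definition cyl_obj (x : C) (i : nat) : D := if i is 0 then F x else G x.

(** The interval coordinate is read as a natural number so that the match computes; [cylinder] uses
    only the values 0 and 1, and no arrow goes from 1 back to 0. *)
Definition cyl_map (x y : C) (f : hom x y) (i j : nat) :
    i <= j -> hom (cyl_obj x i) (cyl_obj y j) :=
  match i, j return i <= j -> hom (cyl_obj x i) (cyl_obj y j) with
  | 0, 0 => fun _ => fmap F f
  | 0, _.+1 => fun _ => eta y ∘ fmap F f
  | _.+1, 0 => fun ij => match notF ij with end
  | _.+1, _.+1 => fun _ => fmap G f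
  end.

Lemma cyl_map_id (x : C) (i : nat) (ii : i <= i) :
  cyl_map (idm x) ii = idm (cyl_obj x i).
Proof. by case: i ii => [|i] ii /=; rewrite fmap_id. Qed.

Lemma cyl_map_comp (x y z : C) (g : hom y z) (f : hom x y) (i j k : nat)
    (jk : j <= k) (ij : i <= j) (ik : i <= k) :
  cyl_map (g ∘ f) ik = cyl_map g jk ∘ cyl_map f ij.
Proof.
case: i j k ij jk ik => [|i] [|j] [|k] //= ij jk ik;
  rewrite fmap_comp ?compA //.
by rewrite eta_nat.
Qed.

Program Definition cylinder : functor (cat_prod C (ord_category 1)) D :=
  @Functor (cat_prod C (ord_category 1)) D (fun p => cyl_obj p.1 p.2)
    (fun p q f => cyl_map f.1 f.2) _ _.
Next Obligation. exact: cyl_map_id. Qed.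
Next Obligation. exact: cyl_map_comp. Qed.

End Cylinder.

Program Definition nerve_map (C D : category) (F : functor C D) :
    smap (nerve C) (nerve D) :=
  @PresheafMap Delta (nerve C) (nerve D) (fun n s => functor_comp F s) _.
Next Obligation. exact: functor_compA. Qed.

(** An m-simplex of [nerve C] times Delta^1 is a functor from an ordinal to C x [1]; composing it
    with the cylinder gives the homotopy. *)
Lemma natural_step_homotopy (C D : category) (F G : functor C D) :
  natural_step F G -> simplicial_homotopy (nerve_map F) (nerve_map G).
Proof.
case=> eta eta_nat.
pose comp m (p : presheaf_prod (nerve C) (simplex 1) m) : nerve D m :=
  functor_comp (cylinder eta_nat) (functor_pair p.1 (ord_functor p.2)).
have compN (m n : Delta) (u : hom m n) p :
    comp m (restr (presheaf_prod (nerve C) (simplex 1)) u p) =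
    restr (nerve D) u (comp n p).
  by rewrite /comp /= ord_functor_comp; congr Functor.
by exists (PresheafMap compN); split=> m s; apply: functor_eq.
Qed.

Section Homotopy.
Variables X Y Z : sset.

Lemma presheaf_map_compA (W : sset) (h : smap Z W) (g : smap Y Z)
    (f : smap X Y) :
  presheaf_map_comp h (presheaf_map_comp g f) =
  presheaf_map_comp (presheaf_map_comp h g) f.
Proof. exact: presheaf_map_eq. Qed.

Lemma homotopic_compl (h : smap Y Z) (f g : smap X Y) :
  homotopic f g -> homotopic (presheaf_map_comp h f) (presheaf_map_comp h g).
Proof.
elim=> [f1 f2 [H [H0 H1]]|f1|f1 f2 _|f1 f2 f3 _ h12 _ h23].
- apply: rst_step; exists (presheaf_map_comp h H).
  by split=> m x /=; rewrite ?H0 ?H1.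
- exact: rst_refl.
- exact: rst_sym.
- exact: rst_trans h12 h23.
Qed.

Lemma homotopic_compr (h : smap X Y) (f g : smap Y Z) :
  homotopic f g -> homotopic (presheaf_map_comp f h) (presheaf_map_comp g h).
Proof.
elim=> [f1 f2 [H [H0 H1]]|f1|f1 f2 _|f1 f2 f3 _ h12 _ h23].
- have HN (m n : Delta) (u : hom m n)
      (p : presheaf_prod X (simplex 1) n) :
      H m (h m (restr X u p.1), restr (simplex 1) u p.2) =
      restr Z u (H n (h n p.1, p.2)).
    by rewrite component_nat -(component_nat H).
  apply: rst_step; exists (@PresheafMap Delta (presheaf_prod X (simplex 1)) Z
    (fun m p => H m (h m p.1, p.2)) HN).
  by split=> m x /=; rewrite ?H0 ?H1.
- exact: rst_refl.
- exact: rst_sym.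
- exact: rst_trans h12 h23.
Qed.

End Homotopy.

Lemma linked_homotopic (C D : category) (F G : functor C D) :
  linked F G -> homotopic (nerve_map F) (nerve_map G).
Proof.
elim=> [F1 F2 /natural_step_homotopy F12|F1|F1 F2 _|F1 F2 F3 _ h12 _ h23].
- exact: rst_step.
- exact: rst_refl.
- exact: rst_sym.
- exact: rst_trans h12 h23.
Qed.

Lemma linked_comp (B C D E : category) (H : functor D E) (K : functor B C)
    (F G : functor C D) :
  linked F G ->
  linked (functor_comp H (functor_comp F K))
    (functor_comp H (functor_comp G K)).
Proof.
elim=> [F1 F2 [eta eta_nat]|F1|F1 F2 _|F1 F2 F3 _ h12 _ h23].
- apply: rst_step; exists (fun x => fmap H (eta (K x))) => x y f /=.
  by rewrite -!fmap_comp eta_nat.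
- exact: rst_refl.
- exact: rst_sym.
- exact: rst_trans h12 h23.
Qed.

(** The vertex [x0] gives a homotopy inverse of [to_point], and precomposition with a homotopy
    equivalence is bijective on homotopy classes. *)
Lemma contractible_aspherical (C : category) : contractible C -> aspherical C.
Proof.
case=> x0 /linked_homotopic idx0 Z _.
pose v : nerve C 0 := functor_const (ord_category 0) x0.
pose pt : smap (simplex 0) (nerve C) := yoneda_map v.
have ptE : nerve_map (functor_const C x0) =
    presheaf_map_comp pt (to_point (nerve C)).
  by apply: presheaf_map_eq => n s /=; apply: functor_eq.
split=> [g g' /(homotopic_compr pt)|h].
  (* [to_point] after [pt] is the identity of Delta^0. *)
  have E (k : smap (simplex 0) Z) :
      presheaf_map_comp (presheaf_map_comp k (to_point (nerve C))) pt = k.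
    apply: presheaf_map_eq => n s /=; congr (k n _).
    by apply: monotone_eq => i; rewrite !ord1.
  by rewrite !E.
exists (presheaf_map_comp h pt).
rewrite -presheaf_map_compA -ptE.
have {2}-> : h = presheaf_map_comp h (nerve_map (functor_id C)).
  apply: presheaf_map_eq => n s /=; congr (h n _).
  by apply: functor_eq.
exact/homotopic_compl/rst_sym.
Qed.

(** Whiskering the zigzag of [C] by [F] and [G] links F G to a constant, and the given
    transformation links the identity of [D] to F G. *)
Lemma contractible_retract (C D : category) (F : functor C D)
    (G : functor D C) :
  natural_step (functor_id D) (functor_comp F G) ->
  contractible C -> contractible D.
Proof.
move=> idFG [x0 idx0]; exists (F x0).
apply: rst_trans (rst_step _ _ _ _ idFG) _.
have -> : functor_comp F G = functor_comp F (functor_comp (functor_id C) G).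
  by congr Functor.
apply: rst_trans (linked_comp F G idx0) _.
(* Both functors are constant at [F x0]; their arrows agree by [fmap_id], so identities form a
   transformation. *)
by apply: rst_step; exists (fun _ => idm _) => x y f /=;
  rewrite fmap_id !comp_idl.
Qed.

Lemma terminal_contractible (C : category) : has_terminal C -> contractible C.
Proof.
case=> t tP; exists t; apply: rst_step.
exists (fun x => sval (cid (tP x))) => x y f.
have [h [_ hU]] := tP x.
by rewrite -[LHS]hU // -[RHS]hU.
Qed.

(** * Replacing a functor by a terminal object off a sieve *)

Section Cut.
Variables (D : category) (e : D) (eP : terminal e).

Definition to_terminal (x : D) : hom x e := sval (cid (eP x)).

Lemma to_terminal_uniq (x : D) (f g : hom x e) : f = g.
Proof. by have [h [_ hU]] := eP x; rewrite -(hU f) // -(hU g). Qed.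

Definition is_sieve (C : category) (K : C -> Prop) : Prop :=
  forall x y, hom x y -> K y -> K x.

Variables (C : category) (K : C -> Prop) (KP : is_sieve K) (F : functor C D).

Definition cut_obj (x : C) : D := if pselect (K x) then F x else e.

(** An arrow from outside [K] into [K] would contradict [KP]; an arrow with target outside [K] must
    go to the unique map into [e]. *)
Definition cut_map (x y : C) (f : hom x y) : hom (cut_obj x) (cut_obj y) :=
  match pselect (K x) as p, pselect (K y) as q
    return hom (if p then F x else e) (if q then F y else e) with
  | left _, left _ => fmap F f
  | right nKx, left Ky => match nKx (KP f Ky) with end
  | _, right _ => to_terminal _
  end.

Program Definition cut : functor C D := @Functor C D cut_obj cut_map _ _.
Next Obligation.
rewrite /cut_map /cut_obj; case: pselect => Kx; first exact: fmap_id.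
exact: to_terminal_uniq.
Qed.
Next Obligation.
rewrite /cut_map /cut_obj.
case: (pselect (K z)) => Kz; last exact: to_terminal_uniq.
case: (pselect (K y)) => Ky; last by case: (Ky (KP g Kz)).
case: (pselect (K x)) => Kx; last by case: (Kx (KP f Ky)).
exact: fmap_comp.
Qed.

Lemma cut_full : (forall x, K x) -> cut = F.
Proof.
move=> Kfull; apply: functor_eq => [x|x y f] /=.
  by rewrite /cut_obj; case: pselect.
rewrite /cut_map /cut_obj.
by case: (pselect (K x)) => // Kx; case: (pselect (K y)).
Qed.

Lemma cut_empty : (forall x, ~ K x) -> cut = functor_const C e.
Proof.
move=> K0; apply: functor_eq => [x|x y f] /=.
  by rewrite /cut_obj; case: pselect => // Kx; case: (K0 x).
rewrite /cut_map /cut_obj.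
case: (pselect (K x)) => [Kx|nKx]; first by case: (K0 x).
case: (pselect (K y)) => [Ky|nKy]; first by case: (K0 y).
by congr existT; apply: to_terminal_uniq.
Qed.

End Cut.

(** [L] is kept apart from the preimage of [K] so that it can be chosen freely: below it is the
    sieve of another object, everything, or nothing. *)
Lemma cut_comp (D : category) (e : D) (eP : terminal e) (B C : category)
    (H : functor B C) (K : C -> Prop) (KP : is_sieve K) (L : B -> Prop)
    (LP : is_sieve L) (F : functor C D) :
  (forall x, L x <-> K (H x)) ->
  functor_comp (cut eP KP F) H = cut eP LP (functor_comp F H).
Proof.
move=> LK; have eL : L = fun x => K (H x) by apply/funext => x; apply/propext.
subst L; apply: functor_eq => [x|x y f] //=.
by rewrite /cut_map /cut_obj /=; case: pselect => Kx; case: pselect => Ky.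
Qed.

(** * Contracting a category of elements *)

Section ElementsFunctor.
Variables (A : category) (Y : presheaf A) (P : functor A A).
Variable phi : forall S, Y S -> Y (P S).
Hypothesis phiN : forall S R (f : hom S R) (y : Y R),
  restr Y (fmap P f) (phi y) = phi (restr Y f y).

Lemma elements_functor_hom (s t : elements Y) (f : hom s t) :
  restr Y (fmap P (sval f)) (phi (projT2 t)) = phi (projT2 s).
Proof. by rewrite phiN (svalP f). Qed.

(** The datum [phi] amounts to a presheaf map from [Y] to its pullback along [P]. *)
Program Definition elements_functor : functor (elements Y) (elements Y) :=
  @Functor (elements Y) (elements Y)
    (fun s => existT Y (P (projT1 s)) (phi (projT2 s)))
    (fun s t f => exist _ (fmap P (sval f)) (elements_functor_hom f)) _ _.
Next Obligation. by apply: elements_hom_eq; apply: fmap_id. Qed.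
Next Obligation. by apply: elements_hom_eq; apply: fmap_comp. Qed.

End ElementsFunctor.

(* [P2 S -> S] plays the role of the projection [S x I -> S] from the product
   with an interval [I], whose ends are [P0 S] and [P1 S]. *)
Section LocalTest.
Variables (A : category) (P0 P1 P2 : functor A A).
Variables (c : forall S, hom (P2 S) S) (d0 : forall S, hom (P0 S) (P2 S))
  (d1 : forall S, hom (P1 S) (P2 S)).
Hypotheses
  (cN : forall S R (f : hom S R), c R ∘ fmap P2 f = f ∘ c S)
  (d0N : forall S R (f : hom S R), d0 R ∘ fmap P0 f = fmap P2 f ∘ d0 S)
  (d1N : forall S R (f : hom S R), d1 R ∘ fmap P1 f = fmap P2 f ∘ d1 S).
Variable K : forall S, slice (P2 S) -> Prop.
Hypotheses (KP : forall S, is_sieve (K (S := S)))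
  (KN : forall S R (f : hom S R) x, K (slice_map (fmap P2 f) x) <-> K x)
  (K0 : forall S x, K (slice_map (d0 S) x))
  (K1 : forall S x, ~ K (slice_map (d1 S) x)).

Lemma cd0N (S R : A) (f : hom S R) :
  c R ∘ d0 R ∘ fmap P0 f = f ∘ (c S ∘ d0 S).
Proof. by rewrite -compA d0N compA cN -compA. Qed.

Lemma cd1N (S R : A) (f : hom S R) :
  c R ∘ d1 R ∘ fmap P1 f = f ∘ (c S ∘ d1 S).
Proof. by rewrite -compA d1N compA cN -compA. Qed.

Variables (D : category) (e : D) (eP : terminal e) (T : A).

Let Y := presheaf_prod (yoneda T) (iota_star A D).

Definition end0_section (S : A) (y : Y S) : Y (P0 S) :=
  restr Y (c S ∘ d0 S) y.

(** Only the functor component is cut; the map to [T] is just composed with the collapse [c S]. *)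
Definition cut_section (S : A) (y : Y S) : Y (P2 S) :=
  (y.1 ∘ c S, cut eP (KP (S := S)) (functor_comp y.2 (slice_map (c S)))).

Definition end1_section (S : A) (y : Y S) : Y (P1 S) :=
  (y.1 ∘ (c S ∘ d1 S), functor_const (slice (P1 S)) e).

Lemma end0_sectionN (S R : A) (f : hom S R) (y : Y R) :
  restr Y (fmap P0 f) (end0_section y) = end0_section (restr Y f y).
Proof. by rewrite -[LHS]restr_comp cd0N restr_comp. Qed.

Lemma cut_sectionN (S R : A) (f : hom S R) (y : Y R) :
  restr Y (fmap P2 f) (cut_section y) = cut_section (restr Y f y).
Proof.
rewrite /cut_section /=; congr pair; first by rewrite -!compA cN.
(* By [KN] the sieve over [P2 S] is the preimage of the one over [P2 R]. *)
rewrite (@cut_comp _ _ _ _ _ _ _ _ (K (S := S)) (KP (S := S))); last first.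
  by move=> x; rewrite KN.
by rewrite -!functor_compA -!slice_map_comp cN.
Qed.

Lemma end1_sectionN (S R : A) (f : hom S R) (y : Y R) :
  restr Y (fmap P1 f) (end1_section y) = end1_section (restr Y f y).
Proof.
rewrite /end1_section /=; congr pair; last by congr Functor.
by rewrite -compA cd1N compA.
Qed.

(** By [K0] the whole slice over [P0 S] lands in the sieve, where cutting changes nothing. *)
Lemma cut_section_end0 (S : A) (y : Y S) :
  restr Y (d0 S) (cut_section y) = end0_section y.
Proof.
rewrite /cut_section /end0_section /= compA.
rewrite (@cut_comp _ _ _ _ _ _ _ _ (fun _ => True) (fun _ _ _ => id)).
  by rewrite cut_full // slice_map_comp functor_compA.
by move=> x; split=> // _; apply: K0.
Qed.

(** By [K1] no object over [P1 S] lands in the sieve, so every value becomes [e] and the dependence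
    on [y.2] disappears. *)
Lemma cut_section_end1 (S : A) (y : Y S) :
  restr Y (d1 S) (cut_section y) = end1_section y.
Proof.
rewrite /cut_section /end1_section /= compA.
rewrite (@cut_comp _ _ _ _ _ _ _ _ (fun _ => False) (fun _ _ _ => id)).
  by rewrite cut_empty => [|_ []].
by move=> x; split=> // /K1.
Qed.

Lemma elements_contractible : contractible (elements Y).
Proof.
pose t1 : elements Y := existT Y T (idm T, functor_const (slice T) e).
exists t1.
have step0 : natural_step (elements_functor end0_sectionN)
    (functor_id (elements Y)).
  unshelve eexists; first by move=> s; exists (c (projT1 s) ∘ d0 (projT1 s)).
  by move=> s t f; apply: elements_hom_eq; apply: cd0N.
have step1 : natural_step (elements_functor end0_sectionN)
    (elements_functor cut_sectionN).
  exists (fun s => exist _ (d0 (projT1 s)) (cut_section_end0 (projT2 s))).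
  by move=> s t f; apply: elements_hom_eq; apply: d0N.
have step2 : natural_step (elements_functor end1_sectionN)
    (elements_functor cut_sectionN).
  exists (fun s => exist _ (d1 (projT1 s)) (cut_section_end1 (projT2 s))).
  by move=> s t f; apply: elements_hom_eq; apply: d1N.
(* The component is the arrow from [P1 S] to [T] stored in [end1_section]; constant functors
   restrict to constant functors, so it is an arrow of elements. *)
have step3 : natural_step (elements_functor end1_sectionN)
    (functor_const (elements Y) t1).
  unshelve eexists.
    move=> s; exists ((projT2 s).1 ∘ (c (projT1 s) ∘ d1 (projT1 s))).
    by rewrite /= /end1_section comp_idl; congr pair; congr Functor.
  move=> s t f; apply: elements_hom_eq => /=.
  rewrite comp_idl -compA cd1N compA.
  by rewrite -(congr1 fst (svalP f) : _ ∘ _ = (projT2 s).1).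
apply: rst_trans (rst_sym _ _ _ _ (rst_step _ _ _ _ step0)) _.
apply: rst_trans (rst_step _ _ _ _ step1) _.
apply: rst_trans (rst_sym _ _ _ _ (rst_step _ _ _ _ step2)) _.
exact: rst_step step3.
Qed.

End LocalTest.

(** The two categories hold the same data bracketed differently: ((S, x), S -> T) against (S, (S ->
    T, x)). *)
Lemma comma_contractible (A : category) (X : presheaf A) (T : A) :
  contractible (elements (presheaf_prod (yoneda T) X)) ->
  contractible (comma (elements_forget X) T).
Proof.
pose Y := presheaf_prod (yoneda T) X.
pose FP (s t : elements Y) (f : hom s t) :
    restr X (sval f) (projT2 t).2 = (projT2 s).2 := congr1 snd (svalP f).
pose FP1 (s t : elements Y) (f : hom s t) :
    (projT2 t).1 ∘ sval f = (projT2 s).1 := congr1 fst (svalP f).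
pose C := comma (elements_forget X) T.
pose Fo (s : elements Y) : C :=
  existT (fun c => hom (elements_forget X c) T)
    (existT X (projT1 s) (projT2 s).2) (projT2 s).1.
pose Fm (s t : elements Y) (f : hom s t) : hom (Fo s) (Fo t) :=
  exist _ (exist _ (sval f) (FP s t f)) (FP1 s t f).
pose Go (s : C) : elements Y :=
  existT Y (projT1 (projT1 s)) (projT2 s, projT2 (projT1 s)).
have GP (s t : C) (f : hom s t) :
    restr Y (sval (sval f)) (projT2 (Go t)) = projT2 (Go s).
  by rewrite /= (svalP (sval f)); congr pair; apply: (svalP f).
pose Gm (s t : C) (f : hom s t) : hom (Go s) (Go t) :=
  exist _ (sval (sval f)) (GP s t f).
unshelve eapply (@contractible_retract (elements Y) C
  (@Functor _ _ Fo Fm _ _) (@Functor _ _ Go Gm _ _)).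
- by move=> s; do 2!apply/eq_exist.
- by move=> s t r g f; do 2!apply/eq_exist.
- by move=> s; apply/eq_exist.
- by move=> s t r g f; apply/eq_exist.
(* The transformation is carried by identities of the underlying objects. *)
unshelve eexists.
  move=> s; unshelve eexists.
    by exists (idm (projT1 (projT1 s))); apply: restr_id.
  by rewrite /= comp_idr.
move=> s t f; do 2!apply: eq_exist; rewrite /=.
by rewrite comp_idl comp_idr.
Qed.

(** * Wedges and maps out of them *)

Lemma presheaf_map_compE (A : category) (X Y Z : presheaf A)
    (g : presheaf_map Y Z) (f : presheaf_map X Y) (a : A) (x : X a) :
  presheaf_map_comp g f a x = g a (f a x).
Proof. by []. Qed.

Definition const_map (X Z : sset) (v : Z 0) : smap X Z :=
  presheaf_map_comp (yoneda_map v) (to_point X).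

Lemma const_map_vertex (X Z : sset) (v : Z 0) (x : X 0) :
  const_map X v 0 x = v.
Proof.
rewrite /= -[RHS](restr_id (p := Z)); congr (restr Z _ v).
by apply: monotone_eq => i; rewrite !ord1.
Qed.

Section Wedge.
Variables K L : bipointed.

Program Definition wedge_inl : smap K (wedge K L) :=
  @PresheafMap Delta K (wedge K L)
    (fun m x => coeq_pi (wedge_fst K L) (wedge_snd K L) (inl x)) _.
Next Obligation. by rewrite coeq_restr_pi. Qed.

Program Definition wedge_inr : smap L (wedge K L) :=
  @PresheafMap Delta L (wedge K L)
    (fun m y => coeq_pi (wedge_fst K L) (wedge_snd K L) (inr y)) _.
Next Obligation. by rewrite coeq_restr_pi. Qed.

Lemma wedge_glue : wedge_inl 0 (bip_snd K) = wedge_inr 0 (bip_fst L).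
Proof.
apply/coeq_piP; apply: rst_step; exists (monotone_id 0).
by split; apply/esym/(@restr_id Delta (presheaf_coprod K L) 0).
Qed.

(** The two cases overlap on the degenerate simplices at the joint; maps out of the wedge come from
    [wedge_rec] instead. *)
Variant wedge_spec (m : Delta) : wedge K L m -> Prop :=
  | WedgeInl x : wedge_spec (wedge_inl m x)
  | WedgeInr y : wedge_spec (wedge_inr m y).

Lemma wedgeP (m : Delta) (q : wedge K L m) : wedge_spec q.
Proof.
rewrite -(coeq_reprK q); case: (coeq_repr q) => [x|y].
  exact: WedgeInl.
exact: WedgeInr.
Qed.

Variables (M : sset) (f : smap K M) (g : smap L M).
Hypothesis fg : f 0 (bip_snd K) = g 0 (bip_fst L).

Definition coprod_rec (m : Delta) (s : presheaf_coprod K L m) : M m :=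
  match s with inl x => f m x | inr y => g m y end.

(** On a generating pair both values are restrictions of the vertex shared by [fg]; hence
    [wedge_rec] can be computed on any representative. *)
Lemma coprod_rec_glue (m : Delta) (s s' : presheaf_coprod K L m) :
  coeq_pi (wedge_fst K L) (wedge_snd K L) s = coeq_pi _ _ s' ->
  coprod_rec s = coprod_rec s'.
Proof.
move/coeq_piP; elim=> [{}s {}s' [x [-> ->]]|//|//|s1 s2 s3 _ -> _ -> //] /=.
by rewrite !component_nat fg.
Qed.

Program Definition wedge_rec : smap (wedge K L) M :=
  @PresheafMap Delta (wedge K L) M (fun m q => coprod_rec (coeq_repr q)) _.
Next Obligation.
transitivity (coprod_rec (restr (presheaf_coprod K L) u (coeq_repr x))).
  by apply: coprod_rec_glue; rewrite coeq_reprK.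
by case: (coeq_repr x) => z; rewrite /= component_nat.
Qed.

Lemma wedge_rec_inl (m : Delta) (x : K m) : wedge_rec m (wedge_inl m x) = f m x.
Proof. exact: (coprod_rec_glue (s' := inl x)) (coeq_reprK _). Qed.

Lemma wedge_rec_inr (m : Delta) (y : L m) : wedge_rec m (wedge_inr m y) = g m y.
Proof. exact: (coprod_rec_glue (s' := inr y)) (coeq_reprK _). Qed.

End Wedge.

Lemma bip_fst_wedge (K L : bipointed) :
  bip_fst (wedge K L) = wedge_inl K L 0 (bip_fst K).
Proof. by []. Qed.

Lemma bip_snd_wedge (K L : bipointed) :
  bip_snd (wedge K L) = wedge_inr K L 0 (bip_snd L).
Proof. by []. Qed.

Lemma bipointed_compE (K L M : bipointed) (g : bipointed_map L M)
    (f : bipointed_map K L) (m : Delta) (x : K m) :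
  sval (bipointed_comp g f) m x = sval g m (sval f m x).
Proof. by []. Qed.

Section WedgeMap.
Variables (K L K' L' : bipointed) (f : bipointed_map K K')
  (g : bipointed_map L L').

Lemma wedge_map_glue :
  presheaf_map_comp (wedge_inl K' L') (sval f) 0 (bip_snd K) =
  presheaf_map_comp (wedge_inr K' L') (sval g) 0 (bip_fst L).
Proof.
have [_ f1] := svalP f; have [g0 _] := svalP g.
by rewrite !presheaf_map_compE f1 g0 wedge_glue.
Qed.

Lemma wedge_map_ends :
  wedge_rec wedge_map_glue 0 (bip_fst (wedge K L)) = bip_fst (wedge K' L') /\
  wedge_rec wedge_map_glue 0 (bip_snd (wedge K L)) = bip_snd (wedge K' L').
Proof.
have [f0 _] := svalP f; have [_ g1] := svalP g.
rewrite !bip_fst_wedge !bip_snd_wedge wedge_rec_inl wedge_rec_inr.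
by rewrite !presheaf_map_compE f0 g1.
Qed.

Definition wedge_map : bipointed_map (wedge K L) (wedge K' L') :=
  exist _ (wedge_rec wedge_map_glue) wedge_map_ends.

Lemma wedge_map_inl (m : Delta) (x : K m) :
  sval wedge_map m (wedge_inl K L m x) = wedge_inl K' L' m (sval f m x).
Proof. exact: wedge_rec_inl. Qed.

Lemma wedge_map_inr (m : Delta) (y : L m) :
  sval wedge_map m (wedge_inr K L m y) = wedge_inr K' L' m (sval g m y).
Proof. exact: wedge_rec_inr. Qed.

End WedgeMap.

(** * The collapse, the long edge and the broken edge *)

Program Definition add_bead (n : {n : nat | 0 < n}) : functor Nec Nec :=
  @Functor Nec Nec (fun S => n :: S)
    (fun S R f => wedge_map (bipointed_id (std_simplex (sval n))) f) _ _.
Next Obligation.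
apply: bipointed_map_eq => m q; case: q / wedgeP => y.
  by rewrite wedge_map_inl.
by rewrite wedge_map_inr.
Qed.
Next Obligation.
apply: bipointed_map_eq => m q; case: q / wedgeP => w.
  by rewrite bipointed_compE 3!wedge_map_inl.
by rewrite bipointed_compE 3!wedge_map_inr.
Qed.

Section Collapse.
Variables K L : bipointed.

Lemma collapse_glue :
  const_map K (bip_fst L) 0 (bip_snd K) = sval (bipointed_id L) 0 (bip_fst L).
Proof. exact: const_map_vertex. Qed.

Lemma collapse_ends :
  wedge_rec collapse_glue 0 (bip_fst (wedge K L)) = bip_fst L /\
  wedge_rec collapse_glue 0 (bip_snd (wedge K L)) = bip_snd L.
Proof.
rewrite bip_fst_wedge bip_snd_wedge wedge_rec_inl wedge_rec_inr.
by rewrite const_map_vertex.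
Qed.

(** All of [K] goes to the first basepoint of [L]. *)
Definition collapse : bipointed_map (wedge K L) L :=
  exist _ (wedge_rec collapse_glue) collapse_ends.

End Collapse.

Lemma collapse_nat (K L L' : bipointed) (f : bipointed_map L L') :
  bipointed_comp (collapse K L') (wedge_map (bipointed_id K) f) =
  bipointed_comp f (collapse K L).
Proof.
have [f0 _] := svalP f.
apply: bipointed_map_eq => m q; rewrite !bipointed_compE; case: q / wedgeP => w.
  by rewrite wedge_map_inl !wedge_rec_inl /= component_nat f0.
by rewrite wedge_map_inr !wedge_rec_inr.
Qed.

Lemma coface_monotone (n : nat) (k : 'I_n.+2) :
  is_monotone (lift k : 'I_n.+1 -> 'I_n.+2).
Proof. by move=> i j ij; rewrite leq_bump2. Qed.

Definition coface (n : nat) (k : 'I_n.+2) : monotone n n.+1 :=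
  exist _ _ (@coface_monotone n k).

Definition vertex (n m : nat) (s : simplex n m) : 'I_m.+1 -> 'I_n.+1 := sval s.

Definition face_map (n : nat) (k : 'I_n.+2) : smap (simplex n) (simplex n.+1) :=
  yoneda_map (coface k : simplex n.+1 n).

Lemma face_mapE (n : nat) (k : 'I_n.+2) (m : nat) (s : simplex n m) i :
  vertex (face_map k m s) i = lift k (vertex s i).
Proof. by []. Qed.

(** The vertex 1 of Delta^2. *)
Definition mid : 'I_3 := lift ord0 ord0.

Lemma long_edge_ends :
  face_map mid 0 (bip_fst (std_simplex 1)) = bip_fst (std_simplex 2) /\
  face_map mid 0 (bip_snd (std_simplex 1)) = bip_snd (std_simplex 2).
Proof. by split; apply: monotone_eq => i; apply: val_inj. Qed.

Definition long_edge : bipointed_map (std_simplex 1) (std_simplex 2) :=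
  exist _ (face_map mid) long_edge_ends.

Section BrokenEdge.
Variable K : bipointed.

Lemma last_edge_glue :
  presheaf_map_comp (wedge_inl (std_simplex 2) K) (face_map ord0) 0
    (bip_snd (std_simplex 1)) =
  wedge_inr (std_simplex 2) K 0 (bip_fst K).
Proof.
rewrite -wedge_glue presheaf_map_compE; congr (wedge_inl _ _ 0 _).
by apply: monotone_eq => i; apply: val_inj.
Qed.

Lemma broken_edge_glue :
  presheaf_map_comp (wedge_inl (std_simplex 2) K) (face_map ord_max) 0
    (bip_snd (std_simplex 1)) =
  wedge_rec (K := std_simplex 1) last_edge_glue 0
    (bip_fst (wedge (std_simplex 1) K)).
Proof.
rewrite bip_fst_wedge wedge_rec_inl !presheaf_map_compE.
congr (wedge_inl _ _ 0 _).
by apply: monotone_eq => i; apply: val_inj.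
Qed.

Lemma broken_edge_ends :
  wedge_rec (K := std_simplex 1) broken_edge_glue 0
    (bip_fst (wedge (std_simplex 1) (wedge (std_simplex 1) K))) =
    bip_fst (wedge (std_simplex 2) K) /\
  wedge_rec (K := std_simplex 1) broken_edge_glue 0
    (bip_snd (wedge (std_simplex 1) (wedge (std_simplex 1) K))) =
    bip_snd (wedge (std_simplex 2) K).
Proof.
rewrite !bip_fst_wedge !bip_snd_wedge !(wedge_rec_inl, wedge_rec_inr).
split=> //; rewrite presheaf_map_compE; congr (wedge_inl _ _ 0 _).
by apply: monotone_eq => i; apply: val_inj.
Qed.

(** The first bead goes to the edge 01, the second to the edge 12, and [K] is kept. *)
Definition broken_edge :
    bipointed_map (wedge (std_simplex 1) (wedge (std_simplex 1) K))
      (wedge (std_simplex 2) K) :=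
  exist _ (wedge_rec (K := std_simplex 1) broken_edge_glue) broken_edge_ends.

Lemma broken_edge_inl (m : Delta) (x : simplex 1 m) :
  sval broken_edge m (wedge_inl (std_simplex 1) _ m x) =
  wedge_inl (std_simplex 2) K m (face_map ord_max m x).
Proof. exact: (wedge_rec_inl (K := std_simplex 1)). Qed.

Lemma broken_edge_inr_inl (m : Delta) (x : simplex 1 m) :
  sval broken_edge m
    (wedge_inr (std_simplex 1) _ m (wedge_inl (std_simplex 1) K m x)) =
  wedge_inl (std_simplex 2) K m (face_map ord0 m x).
Proof.
rewrite [LHS](wedge_rec_inr (K := std_simplex 1)).
exact: (wedge_rec_inl (K := std_simplex 1)).
Qed.

Lemma broken_edge_inr_inr (m : Delta) (y : K m) :
  sval broken_edge m
    (wedge_inr (std_simplex 1) _ m (wedge_inr (std_simplex 1) K m y)) =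
  wedge_inr (std_simplex 2) K m y.
Proof.
rewrite [LHS](wedge_rec_inr (K := std_simplex 1)).
exact: (wedge_rec_inr (K := std_simplex 1)).
Qed.

Lemma triangle_glue :
  sval (bipointed_id (std_simplex 2)) 0 (bip_snd (std_simplex 2)) =
  const_map K (simplex_const 0 ord_max : simplex 2 0) 0 (bip_fst K).
Proof. by rewrite const_map_vertex. Qed.

(** Collapsing [K] to the vertex 2 lets one test, naturally in [K], which vertices lie at 1. *)
Definition triangle : smap (wedge (std_simplex 2) K) (simplex 2) :=
  wedge_rec (K := std_simplex 2) triangle_glue.

Lemma triangle_inl (m : Delta) (x : simplex 2 m) :
  triangle m (wedge_inl (std_simplex 2) K m x) = x.
Proof. exact: (wedge_rec_inl (K := std_simplex 2)). Qed.

Lemma triangle_inr (m : Delta) (y : K m) i :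
  vertex (triangle m (wedge_inr _ K m y)) i = ord_max.
Proof. by rewrite /triangle wedge_rec_inr. Qed.

(** The first bead lands on the edge 02, and [K] on the vertex 2. *)
Lemma triangle_long_edge (q : wedge (std_simplex 1) K 0) i :
  vertex (triangle 0 (sval (wedge_map long_edge (bipointed_id K)) 0 q)) i
    != mid.
Proof.
case: q / wedgeP => w; last by rewrite wedge_map_inr triangle_inr.
by rewrite wedge_map_inl triangle_inl face_mapE eq_sym neq_lift.
Qed.

(** A simplex of a wedge lies in a single summand, hence over 01, over 12 or at 2; this excludes a
    step from 0 to 2. *)
Lemma triangle_broken_edge (m : Delta)
    (q : wedge (std_simplex 1) (wedge (std_simplex 1) K) m) :
  (forall i, vertex (triangle m (sval broken_edge m q)) i != ord_max) \/
  (forall i, vertex (triangle m (sval broken_edge m q)) i != ord0).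
Proof.
case: q / wedgeP => w.
  left=> i; rewrite broken_edge_inl triangle_inl face_mapE.
  by rewrite eq_sym neq_lift.
right=> i; case: w / wedgeP => w.
  by rewrite broken_edge_inr_inl triangle_inl face_mapE eq_sym neq_lift.
by rewrite broken_edge_inr_inr triangle_inr.
Qed.

End BrokenEdge.

Lemma triangle_nat (K L : bipointed) (f : bipointed_map K L) (m : Delta)
    (q : wedge (std_simplex 2) K m) :
  triangle L m (sval (wedge_map (bipointed_id (std_simplex 2)) f) m q) =
  triangle K m q.
Proof.
case: q / wedgeP => w; first by rewrite wedge_map_inl !triangle_inl.
by rewrite wedge_map_inr /triangle !wedge_rec_inr.
Qed.

Lemma broken_edge_nat (K L : bipointed) (f : bipointed_map K L) :
  bipointed_comp (broken_edge L)
    (wedge_map (bipointed_id _) (wedge_map (bipointed_id _) f)) =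
  bipointed_comp (wedge_map (bipointed_id _) f) (broken_edge K).
Proof.
apply: bipointed_map_eq => m q; rewrite !bipointed_compE; case: q / wedgeP => w.
  by rewrite wedge_map_inl !broken_edge_inl wedge_map_inl.
rewrite wedge_map_inr; case: w / wedgeP => w.
  by rewrite wedge_map_inl !broken_edge_inr_inl wedge_map_inl.
by rewrite wedge_map_inr !broken_edge_inr_inr wedge_map_inr.
Qed.

Lemma long_edge_nat (K L : bipointed) (f : bipointed_map K L) :
  bipointed_comp (wedge_map long_edge (bipointed_id L))
    (wedge_map (bipointed_id _) f) =
  bipointed_comp (wedge_map (bipointed_id _) f)
    (wedge_map long_edge (bipointed_id K)).
Proof.
apply: bipointed_map_eq => m q; rewrite !bipointed_compE; case: q / wedgeP => w.
  by rewrite !wedge_map_inl.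
by rewrite !wedge_map_inr.
Qed.

(** * Directed paths in necklaces *)

(** A directed path of edges between the basepoints, encoded as an induction principle so that no
    lists of edges are handled. *)
Definition path_connected (K : bipointed) : Prop :=
  forall phi : K 0 -> Prop,
    (forall e : K 1, phi (restr K (simplex_const 0 ord0 : monotone 0 1) e) ->
       phi (restr K (simplex_const 0 ord_max : monotone 0 1) e)) ->
    phi (bip_fst K) -> phi (bip_snd K).

Lemma path_connected_simplex (n : nat) : path_connected (std_simplex n).
Proof.
move=> phi phiP.
(* The single edge from 0 to [n] joins the basepoints; it is degenerate for n = 0. *)
pose e (i : 'I_2) : 'I_n.+1 := if i == ord0 then ord0 else ord_max.
have eP : is_monotone e.
  move=> i j ij; rewrite /e; case: eqP => // i0; case: eqP => [j0|_] //.
  by case: i0; apply: val_inj; apply/eqP; rewrite -leqn0 (leq_trans ij) ?j0.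
have := phiP (exist _ e eP); congr (phi _ -> phi _); exact: monotone_eq.
Qed.

(** A path through [K] ends at the joint, where a path through [L] takes over. *)
Lemma path_connected_wedge (K L : bipointed) :
  path_connected K -> path_connected L -> path_connected (wedge K L).
Proof.
move=> connK connL phi phiP phi0.
rewrite bip_snd_wedge; apply: (connL (fun y => phi (wedge_inr K L 0 y))).
  by move=> y; rewrite !component_nat; apply: phiP.
rewrite -wedge_glue; apply: (connK (fun x => phi (wedge_inl K L 0 x))) => //.
by move=> x; rewrite !component_nat; apply: phiP.
Qed.

Lemma path_connected_necklace (T : necklace) :
  path_connected (necklace_sset T).
Proof.
elim: T => [|n T IH]; first exact: path_connected_simplex.
apply: (@path_connected_wedge (std_simplex (sval n)) (necklace_sset T)) IH.
exact: path_connected_simplex.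
Qed.

(* A path from 0 to 2 without steps from 0 to 2 stops at 1. *)
Lemma broken_edge_mid (K L : bipointed)
    (f : bipointed_map K (wedge (std_simplex 1) (wedge (std_simplex 1) L))) :
  path_connected K ->
  exists u : K 0,
    vertex (triangle L 0 (sval (broken_edge L) 0 (sval f 0 u))) ord0 = mid.
Proof.
move=> connK; apply: contrapT => /forallNP nmid.
pose g := presheaf_map_comp (triangle L)
  (sval (bipointed_comp (broken_edge L) f)).
have [gf0 gf1] := svalP (bipointed_comp (broken_edge L) f).
have g0 : vertex (g 0 (bip_fst K)) ord0 = ord0.
  by rewrite [g 0 _](congr1 (triangle L 0) gf0) bip_fst_wedge triangle_inl.
have g1 : vertex (g 0 (bip_snd K)) ord0 = ord_max.
  by rewrite [g 0 _](congr1 (triangle L 0) gf1) bip_snd_wedge triangle_inr.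
(* Without visits to 1, the value 0 propagates along edges and would reach the last vertex, whose
   value is 2. *)
suff : vertex (g 0 (bip_snd K)) ord0 = ord0 by rewrite g1.
apply: (connK (fun x => vertex (g 0 x) ord0 = ord0)) g0 => e.
have gE (u : monotone 0 1) :
    vertex (g 0 (restr K u e)) ord0 = vertex (g 1 e) (u ord0).
  by rewrite (component_nat g).
have nm : vertex (g 0 (restr K (simplex_const 0 ord_max : monotone 0 1) e)) ord0
    <> mid := nmid _.
move: nm; rewrite !gE -[_ ord0]/ord_max -[monotone_fun _ ord0]/ord0.
(* If the edge misses 2, its target is neither 2 nor 1, hence 0; if it misses 0, its source cannot
   be at 0. *)
case: (triangle_broken_edge (sval f 1 e)) => [/(_ ord_max)|/(_ ord0)];
    rewrite -/(g 1 e); last by move=> /eqP g0 _ /g0.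
case: (vertex (g 1 e) _) => -[|[|[|k]]] // k3 ne nm _; first exact: val_inj.
by case: nm; apply: val_inj.
Qed.

(** * The test category conditions for necklaces *)

Lemma Nec_terminal : terminal ([::] : Nec).
Proof.
move=> T; have ends : to_point (necklace_sset T) 0 (bip_fst (necklace_sset T)) =
      bip_fst (std_simplex 0) /\
    to_point (necklace_sset T) 0 (bip_snd (necklace_sset T)) =
      bip_snd (std_simplex 0).
  by split; apply: monotone_eq => i; rewrite !ord1.
exists (exist _ (to_point (necklace_sset T)) ends); split=> // f _.
apply: bipointed_map_eq => m x; apply: monotone_eq => i.
by rewrite [LHS]ord1 [RHS]ord1.
Qed.

Definition bead1 : {n : nat | 0 < n} := exist _ 1 isT.
Definition bead2 : {n : nat | 0 < n} := exist _ 2 isT.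

(** This is the sieve [K] of the general argument; it is tested on vertices after collapsing [S] to
    2. *)
Definition misses_mid (S : Nec) (x : slice (add_bead bead2 S)) : Prop :=
  forall u : necklace_sset (projT1 x) 0,
    vertex (triangle (necklace_sset S) 0 (sval (projT2 x) 0 u)) ord0 != mid.

Lemma Nec_elements_contractible (D : category) (T : Nec) :
  has_terminal D ->
  contractible (elements (presheaf_prod (yoneda T) (iota_star Nec D))).
Proof.
case=> e eP; apply: (@elements_contractible Nec (add_bead bead1)
  (functor_comp (add_bead bead1) (add_bead bead1)) (add_bead bead2)
  (fun S => collapse (std_simplex 2) (necklace_sset S))
  (fun S => wedge_map long_edge (bipointed_id (necklace_sset S)))
  (fun S => broken_edge (necklace_sset S)) _ _ _ misses_mid _ _ _ _ D e eP).
- by move=> S R f; apply: collapse_nat.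
- by move=> S R f; apply: long_edge_nat.
- by move=> S R f; apply: broken_edge_nat.
- by move=> S x y f Ky u; rewrite -(svalP f); apply: Ky.
- move=> S R f x; split=> Kx u.
    by have := Kx u; rewrite [triangle _ _ _]triangle_nat.
  by rewrite [triangle _ _ _]triangle_nat; apply: Kx.
- by move=> S x u; apply: triangle_long_edge.
(* [U] is a necklace, so the path between its basepoints forces a vertex over 1. *)
- move=> S [U y] Kx.
  have [u /eqP umid] := broken_edge_mid y (path_connected_necklace (T := U)).
  by have := Kx u; rewrite umid.
Qed.

Theorem theorem3p2 :
  test_category Nec /\
  (aspherical Nec /\
   forall D : category, has_terminal D ->
   forall T : Nec,
     aspherical (elements (presheaf_prod (yoneda T) (iota_star Nec D)))).
Proof.
have aNec : aspherical Nec.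
  by apply/contractible_aspherical/terminal_contractible; exists [::];
    apply: Nec_terminal.
split; last first.
  by split=> // D DP T; apply/contractible_aspherical/Nec_elements_contractible.
(* Asphericity of a presheaf concerns the comma categories of the forgetful functor, which
   [comma_contractible] reduces to categories of elements. *)
split=> // D DP T.
exact/contractible_aspherical/comma_contractible/Nec_elements_contractible.
Qed.
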